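(* Let $(f_1,f_2),(f'_1,f'_2)\in\mathcal{F}\times\mathcal{F}$. The following are equivalent: (i) $(f_1,f_2)\simeq(f'_1,f'_2)$; (ii) $(f_1+f_2)/f_i\simeq(f'_1+f'_2)/f'_i$ for $i=1,2$, and $f_1+f_2\simeq f'_1+f'_2$; (iii) $(f_i,f_1+f_2)\simeq(f'_i,f'_1+f'_2)$ for $i=1,2$.
   Context: Let $n,r\ge1$ be integers, $k$ a field which is finite or algebraically closed, $V$ an $r$-dimensional $k$-space and $\mathcal{F}$ the set of $n$-step flags $f:\{0\}=V_0\subseteq V_1\subseteq\cdots\subseteq V_n=V$. $\mathrm{GL}(V)$ acts on $\mathcal{F}$, and diagonally on $\mathcal{F}\times\mathcal{F}$; two pairs of flags are isomorphic, written $\simeq$, if they lie in the same $\mathrm{GL}(V)$-orbit. A flag is viewed as a representation of the linear quiver $\Lambda: 1\to2\to\cdots\to n$ over $k$, with space $V_i$ at vertex $i$ and the inclusions as maps (these are projective representations); sums $f_1+f_2$ are taken vertexwise inside $V$ and are again flags in $V$, and for $g\subseteq f$ (vertexwise inclusion) $f/g$ is the quotient representation. The symbol $\simeq$ between representations (including single flags) denotes isomorphism of representations of $\Lambda$; for single flags this is the same as lying in the same $\mathrm{GL}(V)$-orbit. *)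

(* Defs.v *)
From HB Require Import structures.
From mathcomp Require Import all_boot all_order all_algebra.
From mathcomp Require Import generic_quotient ring_quotient.

Set Implicit Arguments.
Unset Strict Implicit.
Unset Printing Implicit Defensive.

Import GRing.Theory.
Local Open Scope ring_scope.
Local Open Scope quotient_scope.

Definition finite_or_closed (k : fieldType) : Prop :=
  (exists s : seq k, forall x : k, x \in s) \/ GRing.closed_field_axiom k.

Section LmodQuotient.
Variables (k : fieldType) (M : lmodType k) (I : submodClosed M).

(** [Quotient.quot] wants a [zmodClosed] predicate, which a [submodClosed] one
    is not by inheritance. *)
Definition lquot_pred : {pred M} := I.

Fact lquot_pred_zmod_closed : zmod_closed lquot_pred.
Proof.
split=> [|x y xI yI]; first exact: (rpred0 I).
by rewrite /lquot_pred -scaleN1r rpredD // rpredZ.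
Qed.

HB.instance Definition _ :=
  GRing.isZmodClosed.Build M lquot_pred lquot_pred_zmod_closed.

Definition lquot := Quotient.quot lquot_pred.

HB.instance Definition _ := GRing.Zmodule.on lquot.

Definition lpi (x : M) : lquot := \pi_(Quotient.quot lquot_pred) x.

Lemma lpi_eq x y : (lpi x == lpi y) = (x - y \in I).
Proof. exact/esym/(Quotient.idealrBE lquot_pred). Qed.

Lemma lpi_surj (q : lquot) : lpi (repr (q : Quotient.quot lquot_pred)) = q.
Proof. exact: reprK. Qed.

Lemma lpiD x y : lpi (x + y) = lpi x + lpi y.
Proof. exact: (@pi_addr _ _ _ _ _ (Quotient.quot lquot_pred)). Qed.

Definition lquot_scale (a : k) (q : lquot) : lquot :=
  lpi (a *: repr (q : Quotient.quot lquot_pred)).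

Lemma lpiZ a x : lpi (a *: x) = lquot_scale a (lpi x).
Proof.
apply/eqP; rewrite lpi_eq -scalerBr rpredZ // -lpi_eq; apply/eqP.
by rewrite lpi_surj.
Qed.

Fact lquot_scaleA a b q :
  lquot_scale a (lquot_scale b q) = lquot_scale (a * b) q.
Proof. by rewrite -(lpi_surj q) -!lpiZ scalerA. Qed.

Fact lquot_scale1 : left_id 1 lquot_scale.
Proof. by move=> q; rewrite -(lpi_surj q) -lpiZ scale1r. Qed.

Fact lquot_scaleDr : right_distributive lquot_scale +%R.
Proof.
move=> a q q'; rewrite -(lpi_surj q) -(lpi_surj q').
by rewrite -!lpiZ -!lpiD -lpiZ scalerDr.
Qed.

Fact lquot_scaleDl q : {morph lquot_scale^~ q : a b / a + b}.
Proof. by move=> a b; rewrite -(lpi_surj q) -!lpiZ -lpiD scalerDl. Qed.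

HB.instance Definition _ := GRing.Zmodule_isLmodule.Build k lquot
  lquot_scaleA lquot_scale1 lquot_scaleDr lquot_scaleDl.

Fact lpi_is_linear : linear lpi.
Proof. by move=> a x y; rewrite lpiD lpiZ. Qed.

HB.instance Definition _ := GRing.isLinear.Build k M lquot _ lpi lpi_is_linear.

End LmodQuotient.

Section LmodQuotientMap.
Variables (k : fieldType) (M N : lmodType k).
Variables (I : submodClosed M) (J : submodClosed N) (phi : {linear M -> N}).
Hypothesis phiIJ : forall x, x \in I -> phi x \in J.

Definition lquot_map of (forall x, x \in I -> phi x \in J) :=
  fun q : lquot I => lpi J (phi (repr (q : Quotient.quot (lquot_pred I)))).

Lemma lquot_mapE x : lquot_map phiIJ (lpi I x) = lpi J (phi x).
Proof.
apply/eqP; rewrite lpi_eq -linearB; apply: phiIJ; rewrite -lpi_eq.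
by rewrite lpi_surj.
Qed.

Fact lquot_map_is_linear : linear (lquot_map phiIJ).
Proof.
move=> a q q'; rewrite -(lpi_surj q) -(lpi_surj q') -linearP.
by rewrite !lquot_mapE -linearP -linearP.
Qed.

HB.instance Definition _ :=
  GRing.isLinear.Build k (lquot I) (lquot J) _ (lquot_map phiIJ)
    lquot_map_is_linear.

End LmodQuotientMap.

(** The vertices are numbered from 0, so [i : 'I_n] is the vertex i + 1. *)
Record rep (k : fieldType) (n : nat) := Rep {
  rep_sp :> 'I_n -> lmodType k;
  rep_map : forall i j : 'I_n, i.+1 = j :> nat -> {linear rep_sp i -> rep_sp j}
}.

Definition rep_iso (k : fieldType) (n : nat) (M N : rep k n) : Prop :=
  exists phi : forall i : 'I_n, {linear M i -> N i},
    (forall i, bijective (phi i)) /\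
    (forall (i j : 'I_n) (e : i.+1 = j :> nat) (x : M i),
       phi j (rep_map M e x) = rep_map N e (phi i x)).

Record subrep (k : fieldType) (n : nat) (M : rep k n) := Subrep {
  subrep_sp :> forall i : 'I_n, submodClosed (M i);
  subrep_map : forall (i j : 'I_n) (e : i.+1 = j :> nat) (x : M i),
    x \in subrep_sp i -> rep_map M e x \in subrep_sp j
}.

Definition rep_quot (k : fieldType) (n : nat) (M : rep k n) (N : subrep M) :
    rep k n :=
  @Rep k n (fun i => lquot (N i)) (fun i j e => lquot_map (subrep_map (s := N) e)).

Section Flags.
Variables (k : fieldType) (V : vectType k) (n : nat).

Definition is_flag (f : {ffun 'I_n.+1 -> {vspace V}}) : bool :=
  [&& f ord0 == 0%VS, f ord_max == fullv
    & [forall i : 'I_n, (f (widen_ord (leqnSn n) i) <= f (lift ord0 i))%VS]].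

Record flag := Flag {
  flag_val :> {ffun 'I_n.+1 -> {vspace V}};
  _ : is_flag flag_val
}.

HB.instance Definition _ := [isSub for flag_val].
HB.instance Definition _ := [Equality of flag by <:].

Fact flag_add_subproof (f g : flag) :
  is_flag [ffun i => (f i + g i)%VS].
Proof.
have /and3P[/eqP f0 /eqP fn /forallP fS] := valP f.
have /and3P[/eqP g0 /eqP gn /forallP gS] := valP g.
apply/and3P; split; first by rewrite ffunE f0 g0 addv0.
  by rewrite ffunE fn gn addvv.
by apply/forallP=> i; rewrite !ffunE addvS.
Qed.

Definition flag_add (f g : flag) : flag := Flag (flag_add_subproof f g).

(** An endomorphism of a finite-dimensional space with zero kernel is
    invertible. *)
Record GL := MkGL {
  GL_val :> 'End(V);
  GL_ker : lker GL_val == 0%VS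
}.

Fact flag_act_subproof (a : GL) (f : flag) : is_flag [ffun i => (a @: f i)%VS].
Proof.
have /and3P[/eqP f0 /eqP fn /forallP fS] := valP f.
apply/and3P; split; first by rewrite ffunE f0 limg0.
  rewrite ffunE fn eqEdim subvf /= limg_dim_eq // (eqP (GL_ker a)).
  exact: capv0.
by apply/forallP=> i; rewrite !ffunE limgS.
Qed.

Definition flag_act (a : GL) (f : flag) : flag := Flag (flag_act_subproof a f).

Definition pair_act (a : GL) (p : flag * flag) : flag * flag :=
  (flag_act a p.1, flag_act a p.2).

Definition pair_iso (p q : flag * flag) : Prop :=
  exists a : GL, pair_act a p = q.

(** The space of [f] at the vertex i + 1, which is [f] at index i + 1. *)
Definition vertex_sp (f : flag) (i : 'I_n) : {vspace V} := f (lift ord0 i).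

Lemma vertex_spS (f : flag) (i j : 'I_n) :
  i.+1 = j :> nat -> (vertex_sp f i <= vertex_sp f j)%VS.
Proof.
move=> e; have /and3P[_ _ /forallP/(_ j)] := valP f.
by rewrite /vertex_sp; congr (f _ <= _)%VS; apply: val_inj; rewrite /= -e.
Qed.

(** [vsproj W] restricted to a subspace [U] of [W] is the inclusion of [U]
    into [W]; being total, it avoids a proof argument. *)
Definition vincl (U W : {vspace V}) : {linear subvs_of U -> subvs_of W} :=
  @vsproj k V W \o @vsval k V U.

Lemma vinclE (U W : {vspace V}) (x : subvs_of U) :
  (U <= W)%VS -> vsval (vincl U W x) = vsval x.
Proof. by move=> sUW; rewrite /= vsprojK // (subvP sUW) ?subvsP. Qed.

Definition flag_rep (f : flag) : rep k n :=
  @Rep k n (fun i => subvs_of (vertex_sp f i))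
    (fun i j _ => vincl (vertex_sp f i) (vertex_sp f j)).

Definition vsub (U W : {vspace V}) : {pred subvs_of U} :=
  [pred x | vsval x \in W].

Fact vsub_submod_closed (U W : {vspace V}) : submod_closed (@vsub U W).
Proof.
split=> [|a x y]; rewrite !inE ?linear0 ?mem0v //.
by move=> xW yW; rewrite linearP /= memvD ?memvZ.
Qed.

HB.instance Definition _ (U W : {vspace V}) :=
  GRing.isSubmodClosed.Build k (subvs_of U) (@vsub U W)
    (@vsub_submod_closed U W).

Fact flag_subrep_subproof (f g : flag) (i j : 'I_n) (e : i.+1 = j :> nat)
    (x : flag_rep f i) :
  x \in @vsub (vertex_sp f i) (vertex_sp g i) ->
  rep_map (flag_rep f) e x \in @vsub (vertex_sp f j) (vertex_sp g j).
Proof.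
rewrite !inE => xg; rewrite vinclE ?vertex_spS //.
exact: subvP (vertex_spS g e) _ xg.
Qed.

(** [g] as a subrepresentation of [f], meant for [g] contained in [f]; in
    general this is the vertexwise intersection of [f] and [g]. *)
Definition flag_subrep (f g : flag) : subrep (flag_rep f) :=
  @Subrep k n (flag_rep f)
    (fun i => @vsub (vertex_sp f i) (vertex_sp g i))
    (@flag_subrep_subproof f g).

Definition flag_quot (f g : flag) : rep k n := rep_quot (flag_subrep f g).

End Flags.

(* Main.v *)
From HB Require Import structures.
Require Import Defs.
From mathcomp Require Import all_boot all_order all_algebra.
From mathcomp Require Import zify.

Set Implicit Arguments.
Unset Strict Implicit.
Unset Printing Implicit Defensive.

Import GRing.Theory.

(** Write [A], [B] for the two flags and [S = A + B] for their sum.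

    A pair of flags is determined up to [GL(V)] by the numbers
    [dim (A_i :&: B_j)]. This is the Bruhat decomposition: choosing in each
    [A_i :&: B_j] a complement ([cell]) of the part coming from smaller indices
    writes [V] as a direct sum of cells in which every [A_i] and every [B_j] is
    a partial sum, and the dimensions of the cells are differences of the
    numbers [dim (A_i :&: B_j)]. Two pairs with the same numbers are then
    carried to each other cell by cell ([filtrations_iso],
    [pair_iso_of_cap_dim]).

    Both the second and the third condition yield these numbers, through the
    numbers [dim S_i] and, for [i <= j], [dim (S_i :&: A_j)] and
    [dim (S_i :&: B_j)]. Indeed [A_i] lies in [A_j], so the modular law gives
    [(A_i + B_i) :&: A_j = A_i + (B_i :&: A_j)], from which
    [dim (B_i :&: A_j)] can be computed; exchanging [A] and [B] covers the
    remaining pairs of indices ([pair_iso_of_add_dim]). For pairs of flags the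
    numbers are visibly invariant under [GL(V)]. For representations,
    [dim S_i - dim (S_i :&: A_j)] is the rank of the map of [S / A] from the
    vertex of [S_i] to that of [S_j], which an isomorphism preserves
    ([rep_iso_quot_dim]). Conversely an element of [GL(V)] induces isomorphisms
    of all the representations involved. *)

(** * Linear maps with prescribed behaviour *)

(** Vector spaces are projective: it suffices to lift the images of a basis. *)
Lemma linear_lift (k : fieldType) (X : vectType k) (M Q : lmodType k)
    (p : {linear M -> Q}) (q : {linear X -> Q}) :
  (forall z, exists m, p m = z) ->
  exists h : {linear X -> M}, forall x, p (h x) = q x.
Proof.
move=> p_surj.
have [t pt] : exists t, map p t = map q (vbasis fullv).
  elim: (tval (vbasis fullv)) => [|x s [t pt]]; first by exists [::].
  by have [m pm] := p_surj (q x); exists (m :: t); rewrite /= pm pt.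
have [h hE] := linear_of_free (vbasis {:X}) t; exists h => x.
have {}hE : map h (vbasis fullv) = t.
  apply: hE; first exact: basis_free (vbasisP _).
  by rewrite -(size_map p) pt size_map.
rewrite (coord_vbasis (memvf x)) !linear_sum /=; apply: eq_bigr => i _.
rewrite !linearZ /=; congr (_ *: _)%R.
have lti : (i < size (vbasis {:X}))%N by rewrite size_tuple.
by rewrite -(nth_map _ 0%R h) // hE -(nth_map _ 0%R p) -?(size_map p) ?pt
  ?size_map // (nth_map 0%R).
Qed.

Lemma exists_limg_of_dim (k : fieldType) (V : vectType k) (U W : {vspace V}) :
  \dim U = \dim W -> exists g : 'End(V), (g @: U = W)%VS.
Proof.
move=> dimUW; have [h hE] := linear_of_free (vbasis U) (vbasis W).
exists (linfun h); rewrite -[U in LHS](span_basis (vbasisP U)) limg_span.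
rewrite (eq_map (lfunE h)) hE ?(span_basis (vbasisP W)) //.
  exact: basis_free (vbasisP _).
by rewrite !size_tuple.
Qed.

(** The dimension hypothesis makes the sum of the [C i] direct, so that the maps
    [C i -> C' i] glue along its projections; the result is onto because the
    [C' i] span [V]. *)
Lemma decomposition_iso (k : fieldType) (V : vectType k) (I : finType)
    (C C' : I -> {vspace V}) :
  (\sum_i C i)%VS = fullv -> (\sum_i C' i)%VS = fullv ->
  (\sum_i \dim (C i))%N = \dim {:V} ->
  (forall i, \dim (C i) = \dim (C' i)) ->
  exists g : GL V, forall i, (g @: C i = C' i)%VS.
Proof.
move=> sumC sumC' dimC dimCC'.
have dxC : directv (\sum_i C i) by rewrite directvE /= sumC dimC.
have [e eC] := fin_all_exists (fun i => exists_limg_of_dim (dimCC' i)).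
pose pi i := sumv_pi_for (esym sumC) i.
pose g : 'End(V) := (\sum_i (e i \o pi i)%VF)%R.
have piC i j v : v \in C i -> pi j v = if j == i then v else 0%R.
  move=> Civ; pose w l := if l == i then v else 0%R.
  have Cw l : l \in predT -> w l \in C l.
    by rewrite /w; case: eqP => [->|] // _; rewrite mem0v.
  have Cpi l : l \in predT -> pi l v \in C l by move=> _; apply: memv_sum_pi.
  have: (\sum_(l in predT) pi l v == \sum_(l in predT) w l)%R.
    rewrite sumv_pi_sum ?memvf // (bigD1 i) //= big1 ?addr0 /w ?eqxx //.
    by move=> l /negPf->.
  (* Both families decompose v along the direct sum. *)
  move: (directv_sum_unique dxC _ _ Cpi Cw) => -> /forall_inP/(_ j isT).
  by move/eqP.
have gC i : (g @: C i = C' i)%VS.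
  rewrite -eC; apply: eq_in_limg => v Civ.
  rewrite sum_lfunE (bigD1 i) //= big1 => [|j /negPf ji]; rewrite comp_lfunE.
    by rewrite (piC i) // eqxx addr0.
  by rewrite (piC i) // ji linear0.
have gf : limg g = fullv.
  by rewrite -[X in (g @: X)%VS]sumC limg_sum -sumC'; apply: eq_bigr.
have kg : lker g == 0%VS.
  by rewrite -dimv_eq0 -(eqn_add2r (\dim (limg g))) -{1}[lker g]capfv
    limg_ker_dim gf add0n.
by exists (MkGL kg).
Qed.

(** * Cells of a pair of filtrations *)

(** A choice of graded piece of the bifiltration [A i :&: B j]. The indices are
    shifted by one so that no predecessor occurs. *)
Definition cell (k : fieldType) (V : vectType k) (A B : nat -> {vspace V})
    (i j : nat) : {vspace V} :=
  ((A i.+1 :&: B j.+1) :\: (A i :&: B j.+1 + A i.+1 :&: B j))%VS.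

Section Cells.
Variables (k : fieldType) (V : vectType k) (A B : nat -> {vspace V}).
Hypotheses (A0 : A 0 = 0%VS) (B0 : B 0 = 0%VS).
Hypotheses (AS : forall i, (A i <= A i.+1)%VS).
Hypotheses (BS : forall i, (B i <= B i.+1)%VS).

Let lower_sub i j :
  (A i :&: B j.+1 + A i.+1 :&: B j <= A i.+1 :&: B j.+1)%VS.
Proof. by rewrite subv_add !capvS. Qed.

Let lower_cap i j :
  ((A i :&: B j.+1) :&: (A i.+1 :&: B j) = A i :&: B j)%VS.
Proof.
by rewrite capvA -[((A i :&: _) :&: _)%VS]capvA [(B _ :&: _)%VS]capvC capvA
  (capv_idPl (AS i)) -capvA (capv_idPr (BS j)).
Qed.

Lemma cell_dim i j :
  (\dim (cell A B i j) + \dim (A i :&: B j.+1) + \dim (A i.+1 :&: B j)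
   = \dim (A i.+1 :&: B j.+1) + \dim (A i :&: B j))%N.
Proof.
rewrite -(dimv_cap_compl (A i.+1 :&: B j.+1)
  (A i :&: B j.+1 + A i.+1 :&: B j)) (capv_idPr (lower_sub i j)).
rewrite -/(cell A B i j) -addnA -dimv_sum_cap lower_cap; lia.
Qed.

(** Proved one row at a time: passing from [A p] to [A p.+1] adds exactly the
    cells of row [p]. *)
Lemma cells_span i j :
  (A i :&: B j = \sum_(0 <= p < i) \sum_(0 <= q < j) cell A B p q)%VS.
Proof.
have row p : (A p.+1 :&: B j
    = A p :&: B j + \sum_(0 <= q < j) cell A B p q)%VS.
  elim: j => [|j IHj]; first by rewrite B0 !capv0 big_nil addv0.
  rewrite big_nat_recr //= addvA.
  rewrite -{1}(addv_diff_cap (A p.+1 :&: B j.+1)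
    (A p :&: B j.+1 + A p.+1 :&: B j)) (capv_idPr (lower_sub p j)).
  rewrite -/(cell A B p j) addvC IHj; congr (_ + _)%VS.
  rewrite addvA; congr (_ + _)%VS.
  by apply/addv_idPl; rewrite capvS.
elim: i => [|i IHi]; first by rewrite A0 cap0v big_nil.
by rewrite row IHi big_nat_recr.
Qed.

(** With [cells_span], this says that the sum of the cells is direct. *)
Lemma cells_dim i j :
  (\dim (A i :&: B j)
   = \sum_(0 <= p < i) \sum_(0 <= q < j) \dim (cell A B p q))%N.
Proof.
have row p : (\dim (A p.+1 :&: B j)
    = \dim (A p :&: B j) + \sum_(0 <= q < j) \dim (cell A B p q))%N.
  elim: j => [|j IHj]; first by rewrite B0 !capv0 dimv0 big_nil.
  rewrite big_nat_recr //=; have := cell_dim p j; lia.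
elim: i => [|i IHi]; first by rewrite A0 cap0v dimv0 big_nil.
by rewrite row IHi big_nat_recr.
Qed.

End Cells.

Lemma filtrations_iso (k : fieldType) (V : vectType k) (N : nat)
    (A B A' B' : nat -> {vspace V}) :
  A 0 = 0%VS -> B 0 = 0%VS -> A' 0 = 0%VS -> B' 0 = 0%VS ->
  (forall i, (A i <= A i.+1)%VS) -> (forall i, (B i <= B i.+1)%VS) ->
  (forall i, (A' i <= A' i.+1)%VS) -> (forall i, (B' i <= B' i.+1)%VS) ->
  A N = fullv -> B N = fullv -> A' N = fullv -> B' N = fullv ->
  (forall i j, (i <= N)%N -> (j <= N)%N ->
     \dim (A i :&: B j) = \dim (A' i :&: B' j)) ->
  exists g : GL V, forall i, (i <= N)%N ->
    (g @: A i = A' i)%VS /\ (g @: B i = B' i)%VS.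
Proof.
move=> A0 B0 A'0 B'0 AS BS A'S B'S AN BN A'N B'N dimE.
have pairE (T : Type) (x : T) (op : Monoid.com_law x) (F : nat -> nat -> T) :
    \big[op/x]_(pq : 'I_N * 'I_N) F pq.1 pq.2
      = \big[op/x]_(0 <= p < N) \big[op/x]_(0 <= q < N) F p q.
  rewrite -(pair_bigA _ (fun p q : 'I_N => F p q)) big_mkord.
  by apply: eq_bigr => p _; rewrite big_mkord.
have [||||g gC] := @decomposition_iso k V ('I_N * 'I_N)%type
    (fun pq => cell A B pq.1 pq.2) (fun pq => cell A' B' pq.1 pq.2).
- by rewrite (pairE _ _ _ (cell A B)) -cells_span // AN BN capvv.
- by rewrite (pairE _ _ _ (cell A' B')) -cells_span // A'N B'N capvv.
- by rewrite (pairE _ _ _ (fun p q => \dim (cell A B p q)))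
    -cells_dim // AN BN capvv.
- move=> [p q] /=; have := cell_dim AS BS p q.
  have := cell_dim A'S B'S p q.
  by rewrite !dimE ?(ltnW (ltn_ord _)) ?ltn_ord //; lia.
have gAB i j : (i <= N)%N -> (j <= N)%N ->
    (g @: (A i :&: B j) = A' i :&: B' j)%VS.
  move=> iN jN; rewrite !cells_span // limg_sum.
  apply: eq_big_nat => p /andP[_ pi]; rewrite limg_sum.
  apply: eq_big_nat => q /andP[_ qj].
  exact: (gC (Ordinal (leq_trans pi iN), Ordinal (leq_trans qj jN))).
exists g => i iN; split.
  by have := gAB i N iN (leqnn N); rewrite BN B'N !capvf.
by have := gAB N i (leqnn N) iN; rewrite AN A'N !capfv.
Qed.

(** * Dimensions determined by representations *)

Lemma rep_iso_sym (k : fieldType) (n : nat) (M N : rep k n) :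
  rep_iso M N -> rep_iso N M.
Proof.
case=> phi [phi_bij phiE].
have inv i : exists psi : {linear N i -> M i},
    cancel (phi i) psi /\ cancel psi (phi i).
  have [psi phiK psiK] := phi_bij i.
  pose psiL := GRing.isLinear.Build k _ _ _ psi (GRing.can2_linear phiK psiK).
  by exists (HB.pack_for {linear N i -> M i} psi psiL).
have [psi psiP] := fin_all_exists inv.
exists psi; split=> [i|i j e y].
  by have [phiK psiK] := psiP i; exists (phi i).
have [[phiKj _] [_ psiKi]] := (psiP j, psiP i).
by rewrite -{1}(psiKi y) -phiE phiKj.
Qed.

Lemma rep_iso_dim (k : fieldType) (V : vectType k) (n : nat)
    (f f' : flag V n) :
  rep_iso (flag_rep f) (flag_rep f') ->
  forall i, \dim (vertex_sp f i) = \dim (vertex_sp f' i).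
Proof.
case=> phi [phi_bij _] i; have [psi phiK psiK] := phi_bij i.
pose h : 'Hom(subvs_of (vertex_sp f i), subvs_of (vertex_sp f' i)) :=
  linfun (phi i).
have kh : lker h == 0%VS.
  by apply/lker0P => x y; rewrite !lfunE; apply: can_inj phiK _ _.
have hf : limg h = fullv.
  apply/eqP; rewrite eqEsubv subvf; apply/subvP => y _.
  by rewrite -(psiK y) -(lfunE (phi i)) memv_img ?memvf.
have := limg_dim_eq (f := h) (U := fullv); rewrite (eqP kh) capv0 => /(_ erefl).
by rewrite hf !dimvf.
Qed.

(** The hypotheses say that [h] induces an injection
    [S / (S :&: U) -> S' / (S' :&: U')]; a complement of [U] in [S] stands for
    the first quotient. *)
Lemma codim_le (k : fieldType) (V : vectType k) (h : 'End(V))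
    (S U S' U' : {vspace V}) :
  (h @: S <= S')%VS -> (forall x, x \in S -> h x \in U' -> x \in U) ->
  (\dim S + \dim (S' :&: U') <= \dim S' + \dim (S :&: U))%N.
Proof.
move=> hS hU; pose C := (S :\: U)%VS.
have CU x : x \in C -> h x \in U' -> x = 0%R.
  move=> Cx hx; apply/eqP; rewrite -memv0 -(capv_diff S U) memv_cap Cx.
  by rewrite (hU x) ?(subvP (diffvSl S U)).
have dimhC : \dim (h @: C) = \dim C.
  apply: limg_dim_eq; apply/eqP; rewrite -subv0; apply/subvP => x.
  rewrite memv_cap memv_ker memv0 => /andP[Cx /eqP hx].
  by apply/eqP/CU; rewrite // hx mem0v.
have dxC : (h @: C :&: (S' :&: U') = 0)%VS.
  apply/eqP; rewrite -subv0; apply/subvP => y /memv_capP[/memv_imgP[x Cx ->]].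
  by rewrite memv_cap memv0 => /andP[_ /(CU x Cx)->]; rewrite linear0.
have sub : (h @: C + S' :&: U' <= S')%VS.
  by rewrite subv_add capvSl (subv_trans _ hS) // limgS ?diffvSl.
have := dimvS sub; rewrite dimv_disjoint_sum // dimhC.
have := dimv_cap_compl S U; rewrite -/C; lia.
Qed.

Lemma vertex_sp_le (k : fieldType) (V : vectType k) (n : nat) (f : flag V n)
    (i j : 'I_n) : (i <= j)%N -> (vertex_sp f i <= vertex_sp f j)%VS.
Proof.
case: j => j; elim: j => [|j IHj] jn /= ij.
  suff -> : i = Ordinal jn by exact: subvv.
  by apply: val_inj => /=; lia.
have [eij|nij] := eqVneq (i : nat) j.+1.
  suff -> : i = Ordinal jn by exact: subvv.
  exact: val_inj.
apply: subv_trans (IHj (ltnW jn) _) (vertex_spS _ _); rewrite //=; lia.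
Qed.

(** The codimension of [f_i :&: g_j] in [f_i] is the rank of the map of [f / g]
    from the vertex [i] to the vertex [j]. To compare these ranks inside [V],
    the isomorphism at [i] is lifted to a linear map [H]; by naturality along
    [i -> j], the vectors of [f_i] that [H] maps into [g'_j] are those of
    [g_j]. *)
Lemma rep_iso_quot_dim_le (k : fieldType) (V : vectType k) (n : nat)
    (f g f' g' : flag V n) :
  rep_iso (flag_quot f g) (flag_quot f' g') ->
  forall i j : 'I_n, (i <= j)%N ->
  (\dim (vertex_sp f i) + \dim (vertex_sp f' i :&: vertex_sp g' j)
   <= \dim (vertex_sp f' i) + \dim (vertex_sp f i :&: vertex_sp g j))%N.
Proof.
case=> phi [phi_bij phiE] i j ij.
pose cls (a b : flag V n) l x :
  flag_quot a b l := lpi (flag_subrep a b l) (vsproj (vertex_sp a l) x).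
have cls0 (a b : flag V n) l x : x \in vertex_sp a l ->
    (cls a b l x == 0%R) = (x \in vertex_sp b l).
  move=> ax; rewrite /cls -(linear0 (lpi (flag_subrep a b l))) lpi_eq subr0.
  by rewrite inE vsprojK.
have map_cls (a b : flag V n) (l m : 'I_n) (e : l.+1 = m :> nat) x :
    x \in vertex_sp a l ->
    rep_map (flag_quot a b) e (cls a b l x) = cls a b m x.
  move=> ax; rewrite [LHS]lquot_mapE; congr (lpi _ _); apply: val_inj => /=.
  by rewrite (vsprojK ax).
(* Naturality, carried from i to any later vertex one arrow at a time. *)
have step x y (l : 'I_n) : (i <= l)%N ->
    x \in vertex_sp f i -> y \in vertex_sp f' i ->
    phi i (cls f g i x) = cls f' g' i y ->
    phi l (cls f g l x) = cls f' g' l y.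
  case: l => l; elim: l => [|l IHl] ln il fx f'y xy.
    suff -> : Ordinal ln = i by [].
    by apply: val_inj => /=; move: il => /=; lia.
  have [eil|nil] := eqVneq (i : nat) l.+1.
    by suff -> : Ordinal ln = i by []; apply: val_inj.
  have il' : (i <= Ordinal (ltnW ln))%N by move: il => /=; lia.
  have e : (Ordinal (ltnW ln)).+1 = Ordinal ln :> nat by [].
  rewrite -(map_cls _ _ _ _ e) ?(subvP (vertex_sp_le _ il')) //.
  rewrite phiE IHl // map_cls //.
  exact: subvP (vertex_sp_le _ il') _ f'y.
have [|h hE] := @linear_lift k (subvs_of (vertex_sp f i))
  (subvs_of (vertex_sp f' i)) _ (lpi (flag_subrep f' g' i))
  (phi i \o lpi (flag_subrep f g i)).
  by move=> z; exists (repr (z : Quotient.quot _)); apply: lpi_surj.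
pose H : 'End(V) := linfun (vsval \o h \o vsproj (vertex_sp f i)).
apply: (@codim_le k V H) => [|x fx].
  by apply/subvP => _ /memv_imgP[x _ ->]; rewrite lfunE /= subvsP.
have f'Hx : H x \in vertex_sp f' i by rewrite lfunE /= subvsP.
have phiHx : phi j (cls f g j x) = cls f' g' j (H x).
  by apply: (step x) => //; rewrite /cls /H lfunE /= vsvalK hE.
have [fjx f'jHx] := (subvP (vertex_sp_le f ij) x fx,
  subvP (vertex_sp_le f' ij) (H x) f'Hx).
rewrite -(cls0 f' g' j _ f'jHx) -(cls0 f g j _ fjx) -phiHx => /eqP phi0.
by apply/eqP/(bij_inj (phi_bij j)); rewrite phi0 linear0.
Qed.

Lemma rep_iso_quot_dim (k : fieldType) (V : vectType k) (n : nat)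
    (f g f' g' : flag V n) :
  (forall i, \dim (vertex_sp f i) = \dim (vertex_sp f' i)) ->
  rep_iso (flag_quot f g) (flag_quot f' g') ->
  forall i j : 'I_n, (i <= j)%N ->
  \dim (vertex_sp f i :&: vertex_sp g j)
    = \dim (vertex_sp f' i :&: vertex_sp g' j).
Proof.
move=> dimf iso i j ij; have := rep_iso_quot_dim_le iso ij.
have := rep_iso_quot_dim_le (rep_iso_sym iso) ij; rewrite dimf; lia.
Qed.

(** * The action on flags and on their representations *)

Lemma vertex_sp_act (k : fieldType) (V : vectType k) (n : nat) (a : GL V)
    (f : flag V n) i : vertex_sp (flag_act a f) i = (a @: vertex_sp f i)%VS.
Proof. by rewrite /vertex_sp ffunE. Qed.

Lemma flag_act_add (k : fieldType) (V : vectType k) (n : nat) (a : GL V)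
    (f g : flag V n) :
  flag_act a (flag_add f g) = flag_add (flag_act a f) (flag_act a g).
Proof. by apply/val_inj/ffunP => i; rewrite !ffunE limgD. Qed.

Lemma vertex_sp_add (k : fieldType) (V : vectType k) (n : nat)
    (f g : flag V n) i :
  vertex_sp (flag_add f g) i = (vertex_sp f i + vertex_sp g i)%VS.
Proof. by rewrite /vertex_sp ffunE. Qed.

Definition subvs_map (k : fieldType) (V : vectType k) (h : 'End(V))
    (U W : {vspace V}) : {linear subvs_of U -> subvs_of W} :=
  @vsproj k V W \o (h \o @vsval k V U).

Lemma subvs_mapE (k : fieldType) (V : vectType k) (h : 'End(V))
    (U W : {vspace V}) (x : subvs_of U) :
  (h @: U <= W)%VS -> vsval (subvs_map h U W x) = h (vsval x).
Proof.
by move=> hUW; rewrite /= vsprojK // (subvP hUW) ?memv_img ?subvsP.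
Qed.

Section Action.
Variables (k : fieldType) (V : vectType k) (n : nat) (a : GL V).

Let actK : cancel a (a^-1)%VF. Proof. exact: lker0_lfunK (GL_ker a). Qed.
Let actVK : cancel (a^-1)%VF a. Proof. exact: lker0_lfunVK (GL_ker a). Qed.

Let sub_act (f : flag V n) i :
  (a @: vertex_sp f i <= vertex_sp (flag_act a f) i)%VS.
Proof. by rewrite vertex_sp_act. Qed.

Let sub_actV (f : flag V n) i :
  (a^-1 @: vertex_sp (flag_act a f) i <= vertex_sp f i)%VS.
Proof.
by rewrite vertex_sp_act -limg_comp (lker0_compVf (GL_ker a)) lim1g.
Qed.

Let phi (f : flag V n) i :=
  subvs_map a (vertex_sp f i) (vertex_sp (flag_act a f) i).
Let psi (f : flag V n) i :=
  subvs_map (a^-1)%VF (vertex_sp (flag_act a f) i) (vertex_sp f i).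

Let phiK f i : cancel (phi f i) (psi f i).
Proof. by move=> x; apply: val_inj; rewrite /= !subvs_mapE. Qed.

Let psiK f i : cancel (psi f i) (phi f i).
Proof. by move=> x; apply: val_inj; rewrite /= !subvs_mapE. Qed.

Let phi_map f (i j : 'I_n) (e : i.+1 = j :> nat) x :
  phi f j (rep_map (flag_rep f) e x)
  = rep_map (flag_rep (flag_act a f)) e (phi f i x).
Proof.
apply: val_inj; rewrite /= subvs_mapE // !vinclE ?vertex_spS //.
by rewrite subvs_mapE.
Qed.

Lemma flag_act_rep_iso (f : flag V n) :
  rep_iso (flag_rep f) (flag_rep (flag_act a f)).
Proof.
exists (phi f); split; last exact: phi_map.
by move=> i; exists (psi f i); [apply: phiK | apply: psiK].
Qed.

Let phi_sub f g i x : x \in flag_subrep f g i ->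
  phi f i x \in flag_subrep (flag_act a f) (flag_act a g) i.
Proof. by rewrite !inE => gx; rewrite subvs_mapE // vertex_sp_act memv_img. Qed.

Let psi_sub f g i x : x \in flag_subrep (flag_act a f) (flag_act a g) i ->
  psi f i x \in flag_subrep f g i.
Proof.
rewrite !inE => gx; rewrite subvs_mapE //.
by apply: (subvP (sub_actV g i)); rewrite memv_img.
Qed.

Lemma flag_act_quot_iso (f g : flag V n) :
  rep_iso (flag_quot f g) (flag_quot (flag_act a f) (flag_act a g)).
Proof.
exists (fun i => lquot_map (@phi_sub f g i)); split=> [i|i j e q].
  exists (lquot_map (@psi_sub f g i)) => q; rewrite -(lpi_surj q);
    move: (repr _) => x.
    transitivity (lquot_map (@psi_sub f g i) (lpi _ (phi f i x))).
      by congr (lquot_map _ _); apply: lquot_mapE.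
    by rewrite lquot_mapE phiK.
  transitivity (lquot_map (@phi_sub f g i) (lpi _ (psi f i x))).
    by congr (lquot_map _ _); apply: lquot_mapE.
  by rewrite lquot_mapE psiK.
rewrite -(lpi_surj q); move: (repr _) => x.
transitivity (lquot_map (@phi_sub f g j)
    (lpi (flag_subrep f g j) (rep_map (flag_rep f) e x))).
  by congr (lquot_map _ _); apply: lquot_mapE.
transitivity (rep_map (flag_quot (flag_act a f) (flag_act a g)) e
    (lpi (flag_subrep (flag_act a f) (flag_act a g) i) (phi f i x)));
  last first.
  by congr (rep_map _ _ _); apply/esym/lquot_mapE.
by rewrite [LHS]lquot_mapE [RHS]lquot_mapE; congr (lpi _ _); apply: phi_map.
Qed.

End Action.

(** * Pairs of flags *)

(** Indexing by [nat] matches [cell]; truncating the index at [n], rather than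
    taking a default value beyond it, keeps the filtration increasing. *)
Definition flag_step (k : fieldType) (V : vectType k) (n : nat) (f : flag V n)
    (i : nat) : {vspace V} := f (inord (minn i n)).

Lemma flag_step_vertex (k : fieldType) (V : vectType k) (n : nat)
    (f : flag V n) (i : 'I_n) : flag_step f i.+1 = vertex_sp f i.
Proof.
rewrite /flag_step /vertex_sp (minn_idPl (ltn_ord i)); congr (f _).
by apply: val_inj; rewrite /= inordK ?ltnS ?ltn_ord.
Qed.

Lemma flag_step0 (k : fieldType) (V : vectType k) (n : nat) (f : flag V n) :
  flag_step f 0 = 0%VS.
Proof.
have /and3P[/eqP f0 _ _] := valP f; rewrite -f0 /flag_step min0n.
by congr (f _); apply: val_inj; rewrite /= inordK.
Qed.

Lemma flag_stepn (k : fieldType) (V : vectType k) (n : nat) (f : flag V n) :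
  flag_step f n = fullv.
Proof.
have /and3P[_ /eqP fn _] := valP f; rewrite -fn /flag_step minnn.
by congr (f _); apply: val_inj; rewrite /= inordK.
Qed.

Lemma flag_stepS (k : fieldType) (V : vectType k) (n : nat) (f : flag V n) i :
  (flag_step f i <= flag_step f i.+1)%VS.
Proof.
have [ni|lt_in] := leqP n i.
  by rewrite /flag_step !(minn_idPr _) ?leqW.
have /and3P[_ _ /forallP/(_ (Ordinal lt_in))] := valP f.
rewrite -[f (lift _ _)]/(vertex_sp f _) -flag_step_vertex /=.
congr (_ <= _)%VS; rewrite /flag_step (minn_idPl (ltnW lt_in)); congr (f _).
by apply: val_inj; rewrite /= inordK // ltnS ltnW.
Qed.

Lemma pair_iso_of_cap_dim (k : fieldType) (V : vectType k) (n : nat)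
    (f g f' g' : flag V n) :
  (forall i j, \dim (vertex_sp f i :&: vertex_sp g j)
     = \dim (vertex_sp f' i :&: vertex_sp g' j)) ->
  pair_iso (f, g) (f', g').
Proof.
move=> dimE.
have [|||||||||||||a aE] := @filtrations_iso k V n (flag_step f) (flag_step g)
  (flag_step f') (flag_step g'); rewrite ?flag_step0 ?flag_stepn //;
  try exact: flag_stepS.
  case=> [|i] [|j] lti ltj; rewrite ?flag_step0 ?cap0v ?capv0 //.
  rewrite !(flag_step_vertex _ (Ordinal lti)).
  by rewrite !(flag_step_vertex _ (Ordinal ltj)).
have stepE (h : flag V n) (i : 'I_n.+1) : h i = flag_step h i.
  rewrite /flag_step (minn_idPl _) -1?ltnS ?ltn_ord //.
  by congr (h _); apply: val_inj; rewrite /= inordK.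
exists a; congr (_, _); apply/val_inj/ffunP => i; rewrite ffunE /= !stepE;
  by have [] := aE i (ltn_ord i).
Qed.

(** The modular law [(A + B) :&: A' = A + (B :&: A')], in dimensions. *)
Lemma dim_addv_cap (k : fieldType) (V : vectType k) (A A' B : {vspace V}) :
  (A <= A')%VS ->
  (\dim ((A + B) :&: A') + \dim (A :&: B) = \dim A + \dim (A' :&: B))%N.
Proof.
move=> AA'; rewrite -vspace_modl // [(B :&: A')%VS]capvC.
by rewrite -[RHS]dimv_sum_cap [(A :&: (A' :&: B))%VS]capvA (capv_idPl AA').
Qed.

(** The case [i = j] gives the dimensions of the steps of both flags, hence that
    of [A_i :&: B_i]; [dim_addv_cap] then gives that of [A_j :&: B_i] for
    [i <= j], and symmetrically with [A] and [B] exchanged. *)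
Lemma pair_iso_of_add_dim (k : fieldType) (V : vectType k) (n : nat)
    (f1 f2 f1' f2' : flag V n) :
  let s := flag_add f1 f2 in let s' := flag_add f1' f2' in
  (forall i, \dim (vertex_sp s i) = \dim (vertex_sp s' i)) ->
  (forall i j : 'I_n, (i <= j)%N ->
     \dim (vertex_sp s i :&: vertex_sp f1 j)
     = \dim (vertex_sp s' i :&: vertex_sp f1' j)) ->
  (forall i j : 'I_n, (i <= j)%N ->
     \dim (vertex_sp s i :&: vertex_sp f2 j)
     = \dim (vertex_sp s' i :&: vertex_sp f2' j)) ->
  pair_iso (f1, f2) (f1', f2').
Proof.
move=> s s' dims dim1 dim2.
have dimf1 i : \dim (vertex_sp f1 i) = \dim (vertex_sp f1' i).
  have := dim1 i i (leqnn i); rewrite !vertex_sp_add.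
  by rewrite !(capv_idPr (addvSl _ _)).
have dimf2 i : \dim (vertex_sp f2 i) = \dim (vertex_sp f2' i).
  have := dim2 i i (leqnn i); rewrite !vertex_sp_add.
  by rewrite !(capv_idPr (addvSr _ _)).
have dimc i : \dim (vertex_sp f1 i :&: vertex_sp f2 i)
    = \dim (vertex_sp f1' i :&: vertex_sp f2' i).
  have := dimv_sum_cap (vertex_sp f1 i) (vertex_sp f2 i).
  have := dimv_sum_cap (vertex_sp f1' i) (vertex_sp f2' i).
  by have := dims i; rewrite !vertex_sp_add dimf1 dimf2; lia.
apply: pair_iso_of_cap_dim => i j.
have [ji|/ltnW ij] := leqP j i.
  have := dim1 j i ji; rewrite !vertex_sp_add.
  have := dim_addv_cap (vertex_sp f2 j) (vertex_sp_le f1 ji).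
  have := dim_addv_cap (vertex_sp f2' j) (vertex_sp_le f1' ji).
  by rewrite dimc dimf1; lia.
have := dim2 i j ij; rewrite !vertex_sp_add [(vertex_sp f1 i + _)%VS]addvC.
rewrite [(vertex_sp f1' i + _)%VS]addvC.
have := dim_addv_cap (vertex_sp f1 i) (vertex_sp_le f2 ij).
have := dim_addv_cap (vertex_sp f1' i) (vertex_sp_le f2' ij).
rewrite ![(vertex_sp f2 _ :&: vertex_sp f1 _)%VS]capvC.
rewrite ![(vertex_sp f2' _ :&: vertex_sp f1' _)%VS]capvC.
by rewrite dimc dimf2; lia.
Qed.

Unset Implicit Arguments.

Theorem lemma2p1 (n r : nat) (k : fieldType) (V : vectType k)
    (n_ge1 : (1 <= n)%N) (r_ge1 : (1 <= r)%N)
    (k_fin_or_closed : finite_or_closed k)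
    (dimV : (\dim (@fullv k V))%VS = r)
    (f1 f2 f1' f2' : flag V n) :
  [<-> pair_iso (f1, f2) (f1', f2');
       [/\ rep_iso (flag_quot (flag_add f1 f2) f1)
                   (flag_quot (flag_add f1' f2') f1'),
           rep_iso (flag_quot (flag_add f1 f2) f2)
                   (flag_quot (flag_add f1' f2') f2')
         & rep_iso (flag_rep (flag_add f1 f2))
                   (flag_rep (flag_add f1' f2'))];
       pair_iso (f1, flag_add f1 f2) (f1', flag_add f1' f2')
       /\ pair_iso (f2, flag_add f1 f2) (f2', flag_add f1' f2')].
Proof.
tfae.
- case=> a [<- <-]; rewrite -flag_act_add.
  by split; [apply: flag_act_quot_iso.. | apply: flag_act_rep_iso].
(* The second condition implies the third by way of the first. *)
- case=> iso1 iso2 /rep_iso_dim dims.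
  have [a [<- <-]] : pair_iso (f1, f2) (f1', f2').
    by apply: pair_iso_of_add_dim => // i j ij; apply: rep_iso_quot_dim.
  by rewrite -flag_act_add; split; exists a.
have dim_cap_act (a : GL V) (f g : flag V n) i j :
    \dim (vertex_sp f i :&: vertex_sp g j)
    = \dim (vertex_sp (flag_act a f) i :&: vertex_sp (flag_act a g) j).
  rewrite !vertex_sp_act -lker0_img_cap ?GL_ker // limg_dim_eq //.
  by rewrite (eqP (GL_ker a)) capv0.
case=> [[a aE] [b bE]].
have [/= a1 aS] := (congr1 fst aE, congr1 snd aE).
have [/= b2 bS] := (congr1 fst bE, congr1 snd bE).
apply: pair_iso_of_add_dim => [i|i j _|i j _].
- rewrite -aS; have := dim_cap_act a (flag_add f1 f2) (flag_add f1 f2) i i.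
  by rewrite !capvv.
- by rewrite -aS -a1 -dim_cap_act.
- by rewrite -bS -b2 -dim_cap_act.
Qed.
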